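(* For every integer $k\ge 1$ we have $f(k)\le m(k)\le k\cdot f(k)$, where $m(k)$ is the maximum number of pairs in a strong $3$-sum $(k,k)$-system in $\{0,1,2\}^{<\mathbb{N}}$ and \[ f(k)=\max \frac{(x+y+z)!}{x!\,y!\,z!}, \] the maximum taken over all nonnegative integers $x,y,z$ with $x+z\le k$ and $y+z\le k$.
   Context: Let $Q=\{0,1,\dots,q\}$ and let $Q^{<\mathbb{N}}$ denote the set of infinite sequences $\mathbf{x}=(x_1,x_2,\dots)$ with entries in $Q$ and finite support $S_{\mathbf{x}}=\{i:x_i\neq 0\}$. For $s\ge 1$ and $\mathbf{x},\mathbf{y}\in Q^{<\mathbb{N}}$, put $|\mathbf{x}\cap_s\mathbf{y}|=|\{i: x_i+y_i\ge s\}|$. A system $\{(\mathbf{x}^j,\mathbf{y}^j): j=1,\dots,m\}$ of pairs in $Q^{<\mathbb{N}}\times Q^{<\mathbb{N}}$ with $|\mathbf{x}^j\cap_s\mathbf{y}^j|=0$ for all $j$ is a strong $s$-sum IVP-system if $|\mathbf{x}^i\cap_s\mathbf{y}^j|\neq 0$ for all $i\neq j$. It is a strong $s$-sum $(a,b)$-system if moreover $|S_{\mathbf{x}^j}|\le a$ and $|S_{\mathbf{y}^j}|\le b$ for all $j$. Here $q=2$, $s=3$. *)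

(* Defs.v *)
From mathcomp Require Import all_boot finmap.

Set Implicit Arguments.
Unset Strict Implicit.
Unset Printing Implicit Defensive.

Local Open Scope fset_scope.

(* The coordinates are indexed from 0 rather than from 1. *)
Definition finseq (q : nat) := {fsfun nat -> 'I_q.+1 with ord0}.

(* For s >= 1 a coordinate i with s <= x i + y i lies in one of the two supports,
   so this is the number of all i : nat such that s <= x i + y i. *)
Definition sum_inter (q s : nat) (x y : finseq q) : nat :=
  #|` [fset i in finsupp x `|` finsupp y | s <= x i + y i] |.

(* A family indexed by 'I_m is a set of m pairs: the two conditions force its
   members to be distinct. *)
Definition strong_IVP_system (q s m : nat)
    (P : 'I_m -> finseq q * finseq q) : Prop :=
  (forall j, sum_inter s (P j).1 (P j).2 = 0) /\
  (forall i j, i <> j -> sum_inter s (P i).1 (P j).2 <> 0).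

Definition strong_ab_system (q s a b m : nat)
    (P : 'I_m -> finseq q * finseq q) : Prop :=
  strong_IVP_system s P /\
  (forall j, #|` finsupp (P j).1 | <= a /\ #|` finsupp (P j).2 | <= b).

Definition is_max_size (q s a b m : nat) : Prop :=
  (exists P : 'I_m -> finseq q * finseq q, strong_ab_system s a b P) /\
  (forall (n : nat) (P : 'I_n -> finseq q * finseq q),
      strong_ab_system s a b P -> n <= m).

(* The triple ((x, y), z) ranges over {0, ..., k}^3, which the constraints
   x + z <= k and y + z <= k imply; the division is exact. *)
Definition max_trinomial (k : nat) : nat :=
  \max_(t : 'I_k.+1 * 'I_k.+1 * 'I_k.+1
          | (t.1.1 + t.2 <= k) && (t.1.2 + t.2 <= k))
     ((t.1.1 + t.1.2 + t.2)`! %/ (t.1.1`! * t.1.2`! * t.2`!)).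

(* Main.v *)
Require Import Defs.
From Stdlib Require Import Classical.
From mathcomp Require Import all_boot finmap all_algebra zify.

(* Upper bound. Let [S i], [T i] be the supports of the i-th pair. For [q = 2] and
   [s = 3] the hypotheses give [S i :&: T j] not included in [S j :&: T i] for
   [i <> j]. Among the pairs with [#|S i :&: T i| = c] the matrix
     M i j = \prod_(s in S i :\: T i, t in T j) (t - s)
           * \prod_(s in S i :&: T i, t in T j :\: S j) (t - s)
   is then diagonal with nonzero diagonal, while each factor, read as a form in the
   coefficients of the monic polynomial with the given roots [s], has rank at most a
   binomial coefficient; the two multiply to the trinomial coefficient of
   [(k - c, k - c, c)]. There is at most one pair with [c = k]; deleting one point
   from its second set moves it to the class [c = k - 1], where the matrix becomes
   triangular. This leaves the [k] classes [0 <= c < k].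

   Lower bound. Take all words with [x] letters (2,0), [y] letters (0,2) and [z]
   letters (1,1): two distinct words have equal sums of first entries, so each
   exceeds the other somewhere. *)

Set Implicit Arguments.
Unset Strict Implicit.
Unset Printing Implicit Defensive.

Import GRing.Theory Num.Theory.

(** * Rank bounds for difference products *)

Section AlgebraicBound.

Local Open Scope ring_scope.

(** The matrix of these sums factors through [W], so its rank is at most [#|W|]; being triangular
    for the order given by [r], it has rank [m]. *)
Lemma triangular_factorization_card (F : fieldType) (W : finType) (m : nat)
    (r : 'I_m -> nat) (u : 'I_m -> W -> F) (v : W -> 'I_m -> F) :
    (forall i, \sum_w u i w * v w i != 0) ->
    (forall i j, i != j -> (r j <= r i)%N -> \sum_w u i w * v w j = 0) ->
  (m <= #|W|)%N.
Proof.
move=> diag off.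
pose U := \matrix_(i < m, l < #|W|) u i (enum_val l).
pose V := \matrix_(l < #|W|, j < m) v (enum_val l) j.
have UVE i j : (U *m V) i j = \sum_w u i w * v w j.
  rewrite mxE (reindex (@enum_val W W)) /=; last first.
    by apply: onW_bij; apply: enum_val_bij.
  by apply: eq_bigr => l _; rewrite !mxE.
have free : row_free (U *m V).
  apply: inj_row_free => w wUV0.
  (* Induction on a strict bound for [r j]: in column [j] only the diagonal entry and rows with
     [r i < r j] survive, and [w] already vanishes on the latter. *)
  suff w0 d j : (r j < d)%N -> w 0 j = 0.
    by apply/rowP => j; rewrite (w0 (r j).+1) ?mxE.
  elim: d j => // d IHd j; rewrite ltnS => rj_d.
  have /rowP/(_ j) := wUV0; rewrite mxE (bigD1 j) //= big1 => [|i ij].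
    rewrite [RHS]mxE addr0 UVE => /eqP.
    by rewrite mulf_eq0 (negPf (diag j)) orbF => /eqP.
  case: (ltnP (r i) (r j)) => rij; last by rewrite UVE off ?mulr0.
  by rewrite IHd ?mul0r // (leq_trans rij).
by have := mulmx_max_rank U V; rewrite (eqP free).
Qed.

(** The resultant of the monic polynomials with root sequences [t] and [s]. *)
Definition diff_prod (R : comNzRingType) (s t : seq R) : R :=
  \prod_(x <- s) \prod_(y <- t) (y - x).

Lemma diff_prod_eq0 (F : fieldType) (s t : seq F) :
  (diff_prod s t == 0) = has (mem t) s.
Proof.
rewrite /diff_prod; elim: s => [|x s IHs]; first by rewrite big_nil oner_eq0.
rewrite big_cons mulf_eq0 IHs /=; congr (_ || _).
elim: t {IHs} => [|y t IHt]; first by rewrite big_nil oner_eq0.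
by rewrite big_cons mulf_eq0 IHt inE subr_eq0 eq_sym.
Qed.

(** Sorted tuples stand for multisets: these are the monomials of degree [b] in [a + 1]
    variables. *)
Definition monomial_index (a b : nat) : finType :=
  {t : b.-tuple 'I_a.+1 | sorted leq [seq val i | i <- t]}.

Lemma card_monomial_index a b : #|monomial_index a b| = 'C(a + b, b).
Proof.
by rewrite card_sig addnC -card_sorted_tuples; apply: eq_card => t; rewrite !inE.
Qed.

(* With [p] the monic polynomial with root sequence [s], the product is
   [\prod_(y <- t) p.[y]], a form of degree [b] in the [a + 1] coefficients of [p]. *)
Lemma diff_prod_factorization (R : comNzRingType) (a b : nat) :
  exists (u : seq R -> monomial_index a b -> R)
         (v : monomial_index a b -> seq R -> R),
  forall s t, size s = a -> size t = b ->
    diff_prod s t = \sum_w u s w * v w t.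
Proof.
have sortP (f : {ffun 'I_b -> 'I_a.+1}) :
    let e := sort (relpre val leq) [seq f l | l <- enum 'I_b] in
    size e == b /\ sorted leq [seq val i | i <- e].
  move=> e; rewrite {}/e size_sort size_map size_enum_ord eqxx; split=> //.
  by rewrite sorted_map; apply: sort_sorted => i j; apply: leq_total.
pose key f : monomial_index a b := Sub (Tuple (sortP f).1) (sortP f).2.
pose p (s : seq R) := \prod_(x <- s) ('X - x%:P).
exists (fun s (w : monomial_index a b) => \prod_(i <- tval (sval w)) (p s)`_i).
exists (fun w (t : seq R) => \sum_(f | key f == w) \prod_(l < b) t`_l ^+ f l).
move=> s t sa tb.
have pE y : (p s).[y] = \prod_(x <- s) (y - x).
  by rewrite horner_prod; apply: eq_bigr => x _; rewrite hornerXsubC.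
transitivity (\prod_(l < b) \sum_(i < a.+1) (p s)`_i * t`_l ^+ i).
  rewrite /diff_prod exchange_big /= (big_nth 0) big_mkord tb.
  apply: eq_bigr => l _; rewrite -pE; apply: horner_coef_wide.
  by rewrite size_prod_XsubC sa.
(* Each [f] picks one term per factor; choices with the same sorted values share a monomial in the
   coefficients of [p s]. *)
rewrite bigA_distr_bigA /= (partition_big key xpredT) //=.
apply: eq_bigr => w _; rewrite mulr_sumr; apply: eq_bigr => f /eqP <-.
rewrite big_split /=; congr (_ * _).
by rewrite (perm_big _ (permEl (perm_sort _ _))) big_map big_enum.
Qed.

End AlgebraicBound.

(** * Skew families with constant intersection size *)

Section SkewBound.

Local Open Scope fset_scope.

(* The fillers 0 and 1 stay clear of the shifted elements of [A]. *)
Definition padded (d n : nat) (A : {fset nat}) : seq rat :=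
  [seq x%:R%R | x <- [seq u.+2 | u <- A] ++ nseq (n - #|` A|) d].

Lemma size_padded d n A : #|` A| <= n -> size (padded d n A) = n.
Proof. by move=> An; rewrite size_map size_cat size_map size_nseq subnKC. Qed.

Lemma diff_prod_padded_eq0 n n' A B :
  (diff_prod (padded 0 n A) (padded 1 n' B) == 0)%R = ~~ [disjoint A & B]%fset.
Proof.
rewrite diff_prod_eq0; apply/hasP/fset0Pn => [[_ /mapP[x xA ->]]|[x]].
  rewrite inE mem_map => [xB|y z /eqP]; last by rewrite eqr_nat => /eqP.
  move: xA xB; rewrite !mem_cat !mem_nseq.
  case: x => [|[|x]]; rewrite /= ?andbF ?orbF.
  - by move=> _ /mapP[].
  - by move=> /mapP[].
  rewrite !mem_map => [xA xB||]; first by exists x; rewrite inE xA.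
  - by move=> ? ? [].
  - by move=> ? ? [].
rewrite inE => /andP[xA xB].
by exists x.+2%:R%R; rewrite ?inE; apply/map_f; rewrite mem_cat map_f.
Qed.

Lemma skew_system_bound (m a b c : nat) (r : 'I_m -> nat)
    (S T : 'I_m -> {fset nat}) :
    (forall i, #|` S i `\` T i| <= a) -> (forall i, #|` T i `\` S i| <= b) ->
    (forall i, #|` S i `&` T i| = c) ->
    (forall i j, i != j -> r j <= r i ->
       ~~ (S i `&` T j `<=` S j `&` T i)) ->
  m <= 'C(a + (b + c), b + c) * 'C(c + b, b).
Proof.
move=> Sa Tb STc skew.
have [u1 [v1 uv1]] := diff_prod_factorization rat a (b + c).
have [u2 [v2 uv2]] := diff_prod_factorization rat c b.
rewrite -!card_monomial_index -card_prod.
pose s1 i := padded 0 a (S i `\` T i).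
pose t1 j := padded 1 (b + c) (T j).
pose s2 i := padded 0 c (S i `&` T i).
pose t2 j := padded 1 b (T j `\` S j).
have factor i j :
    (\sum_w (u1 (s1 i) w.1 * u2 (s2 i) w.2) * (v1 w.1 (t1 j) * v2 w.2 (t2 j)) =
     diff_prod (s1 i) (t1 j) * diff_prod (s2 i) (t2 j))%R.
  rewrite uv1 ?uv2 ?size_padded ?STc //; last first.
    by rewrite -(cardfsID (S j)) fsetIC STc addnC leq_add.
  rewrite big_distrlr /= pair_big /=; apply: eq_bigr => w _.
  by rewrite mulrACA.
apply: (@triangular_factorization_card _ _ _ r
  (fun i w => u1 (s1 i) w.1 * u2 (s2 i) w.2)%R
  (fun w j => v1 w.1 (t1 j) * v2 w.2 (t2 j))%R) => [i|i j ij rji].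
  rewrite factor mulf_eq0 !diff_prod_padded_eq0 negb_or !negbK.
  by apply/andP; split; apply/fdisjointP => x; rewrite !inE => /andP[] // ->.
rewrite factor; apply/eqP; rewrite mulf_eq0 !diff_prod_padded_eq0.
(* The point [x] kills the first factor if it is outside [T i]; otherwise it is outside [S j] and
   kills the second. *)
have /fsubsetPn[x] := skew i j ij rji; rewrite !inE => /andP[xS xT] xnot.
case xTi: (x \in T i); apply/orP; [right|left]; apply/fset0Pn; exists x;
  by move: xnot; rewrite !inE xS xT xTi ?andbT.
Qed.

End SkewBound.

Lemma trinomial_div x y z :
  (x + y + z)`! %/ (x`! * y`! * z`!) = 'C(x + (y + z), y + z) * 'C(z + y, y).
Proof.
have bin1 := bin_fact (leq_addl x (y + z)); rewrite addnK in bin1.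
have bin2 := bin_fact (leq_addl z y); rewrite addnK addnC in bin2.
rewrite -addnA -bin1 -bin2 [z + y]addnC.
rewrite (_ : _ * (_ * _) = 'C(x + (y + z), y + z) * 'C(y + z, y) *
  (x`! * y`! * z`!)); last by rewrite -!mulnA; congr (_ * _); rewrite mulnC; lia.
by rewrite mulnK // !muln_gt0 !fact_gt0.
Qed.

Lemma trinomial_le_max k x y z : x + z <= k -> y + z <= k ->
  'C(x + (y + z), y + z) * 'C(z + y, y) <= max_trinomial k.
Proof.
move=> xz yz.
have xk : x < k.+1 by rewrite ltnS (leq_trans _ xz) ?leq_addr.
have yk : y < k.+1 by rewrite ltnS (leq_trans _ yz) ?leq_addr.
have zk : z < k.+1 by rewrite ltnS (leq_trans _ xz) ?leq_addl.
rewrite -trinomial_div /max_trinomial.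
by apply: (@bigop.leq_bigmax_cond _ _ _ (Ordinal xk, Ordinal yk, Ordinal zk));
  rewrite /= xz yz.
Qed.

(** * Upper bound *)

Section UpperBound.

Local Open Scope fset_scope.

Lemma crossing_system_bound (k m : nat) (S T : 'I_m -> {fset nat}) :
    0 < k -> (forall i, #|` S i| <= k) -> (forall i, #|` T i| <= k) ->
    (forall i j, i != j -> ~~ (S i `&` T j `<=` S j `&` T i)) ->
  m <= k * max_trinomial k.
Proof.
move=> k_gt0 Sk Tk cross.
pose full i := k <= #|` S i `&` T i|.
have fullE i : full i -> S i = T i.
  move=> fi; rewrite -[LHS](_ : S i `&` T i = _); last first.
    by apply/eqP; rewrite eqEfcard fsubsetIl (leq_trans (Sk i)).
  by apply/eqP; rewrite eqEfcard fsubsetIr (leq_trans (Tk i)).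
(* A full pair loses one element of [T i]; this only weakens its constraints as
   a second member, which [skew_system_bound] does not need once [r] puts it last. *)
pose T' i := if full i then T i `\ head 0 (S i `&` T i) else T i.
have subT' i : T' i `<=` T i.
  by rewrite /T'; case: ifP => // _; apply: fsubD1set.
have cardST' i : #|` S i `&` T' i| < k.
  rewrite /T'; case: ifPn => [fi|]; last by rewrite -ltnNge.
  set z := head 0 _.
  have zST : z \in S i `&` T i.
    have : 0 < size (S i `&` T i) by apply: leq_trans fi.
    by rewrite /z -nth0 => ?; apply: mem_nth.
  rewrite -ltnS -[_.+1]add1n; apply: leq_trans (_ : #|` S i `&` T i|.+1 <= _).
    by rewrite (cardfsD1 z (S i `&` T i)) zST fsetIDA.
  by rewrite ltnS (leq_trans _ (Sk i)) // fsubset_leq_card // fsubsetIl.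
pose class i := Ordinal (cardST' i).
rewrite -[m in m <= _]card_ord -sum1_card (partition_big class xpredT) //=.
rewrite -[k in k * _]card_ord -sum_nat_const.
apply: leq_sum => c _; rewrite sum1_card.
pose f (i : 'I_#|[pred j | class j == c]|) := enum_val i.
have fc i : #|` S (f i) `&` T' (f i)| = c.
  by have := enum_valP i; rewrite inE => /eqP <-.
have ck : c <= k by apply: ltnW.
have sizek : k - c + c <= k by rewrite subnK.
apply: leq_trans (trinomial_le_max sizek sizek).
apply: (skew_system_bound (r := fun i => full (f i) : nat)
  (S := fun i => S (f i)) (T := fun i => T' (f i))) => [i|i|//|i j ij].
- by rewrite cardfsD fc leq_sub2r.
- by rewrite cardfsD fsetIC fc leq_sub2r // (leq_trans _ (Tk (f i))) ?fsubset_leq_card.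
have fij : f i != f j by rewrite (inj_eq enum_val_inj).
(* If [j] is full, the order [r] makes [i] full too, and two full pairs have equal crossed
   intersections, against [cross]. *)
have := cross _ _ fij; rewrite /T'; case: (boolP (full (f j))) => fj /=.
  case: (boolP (full (f i))) => // fi.
  by rewrite -(fullE _ fi) -(fullE _ fj) fsetIC fsubset_refl.
move=> /fsubsetPn[x xST xnot] _; apply/fsubsetPn; exists x => //.
apply: contra xnot; rewrite !inE => /andP[-> /=].
by case: ifP => // _; rewrite inE => /andP[].
Qed.

(** Outside both supports the sum is 0, which is below [s] since [s] is positive. *)
Lemma sum_inter_eq0 (q s : nat) (x y : finseq q) : 0 < s ->
  sum_inter s x y = 0 <-> forall u, x u + y u < s.
Proof.
move=> s_gt0; rewrite /sum_inter; split=> [/eqP|small].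
  rewrite cardfs_eq0 => /eqP empty u; rewrite ltnNge; apply/negP => large.
  have: u \in [fset i in finsupp x `|` finsupp y | s <= x i + y i].
    rewrite !inE large andbT !mem_finsupp -negb_and; apply: contraTN large.
    by move=> /andP[/eqP-> /eqP->]; rewrite -ltnNge.
  by rewrite empty.
apply/eqP; rewrite cardfs_eq0; apply/eqP/fsetP => u; rewrite !inE.
by rewrite leqNgt small andbF.
Qed.

Lemma strong_system_bound (k m : nat) (P : 'I_m -> finseq 2 * finseq 2) :
  0 < k -> strong_ab_system 3 k k P -> m <= k * max_trinomial k.
Proof.
move=> k_gt0 [[own cross] card].
apply: (@crossing_system_bound k m (fun i => finsupp (P i).1)
  (fun i => finsupp (P i).2)) => // [i|i|i j /eqP ij].
- by case: (card i).
- by case: (card i).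
have ownE l u : (P l).1 u + (P l).2 u < 3.
  by have /sum_inter_eq0-> := own l.
(* At a coordinate with crossed sum at least 3 both entries are nonzero, so by [sub] all four are;
   own sums at most 2 force all four to be 1, a contradiction. *)
apply/negP => sub; apply: (cross i j ij); apply/sum_inter_eq0 => // u.
rewrite ltnNge; apply/negP => large.
have := ownE i u; have := ownE j u.
have : (u \in finsupp (P i).1 `&` finsupp (P j).2) ==>
       (u \in finsupp (P j).1 `&` finsupp (P i).2).
  by apply/implyP/(fsubsetP sub).
rewrite !inE !mem_finsupp -!val_eqE /=; move: large.
have := ltn_ord ((P i).1 u); have := ltn_ord ((P j).2 u); lia.
Qed.

End UpperBound.

(** * Lower bound *)

Section LowerBound.

Local Open Scope fset_scope.
Local Open Scope nat_scope.

Definition finseq_of (q n : nat) (h : 'I_n -> 'I_q.+1) : finseq q :=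
  [fsfun u in [fset val i | i in 'I_n] => if insub u is Some i then h i else ord0].

Lemma finseq_ofE q n (h : 'I_n -> 'I_q.+1) (i : 'I_n) : finseq_of h i = h i.
Proof. by rewrite fsfunE in_imfset ?valK //= insubT. Qed.

Lemma finseq_of_out q n (h : 'I_n -> 'I_q.+1) u : n <= u -> finseq_of h u = ord0.
Proof. by move=> nu; rewrite fsfunE insubN ?if_same // -leqNgt. Qed.

Lemma card_finsupp_finseq_of q n (h : 'I_n -> 'I_q.+1) :
  #|` finsupp (finseq_of h)| <= #|[pred i | h i != ord0]|.
Proof.
rewrite cardE -(size_map val); apply: uniq_leq_size => [|u]; first exact: fset_uniq.
rewrite mem_finsupp => hu; have [un|nu] := ltnP u n; last first.
  by rewrite finseq_of_out ?eqxx in hu.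
rewrite (_ : u = Ordinal un) // in hu *; rewrite map_f // mem_enum inE.
by rewrite -[h _]finseq_ofE.
Qed.

(** A word is given by its positions of (2,0) and of (1,1); the remaining letters are (0,2). *)
Definition trinomial_words (n x z : nat) : {set {set 'I_n} * {set 'I_n}} :=
  [set p : {set 'I_n} * {set 'I_n} |
    (#|p.1| == x) && ((p.2 \subset ~: p.1) && (#|p.2| == z))].

Lemma card_trinomial_words n x z :
  #|trinomial_words n x z| = 'C(n, x) * 'C(n - x, z).
Proof.
rewrite -sum1_card (eq_bigl (fun p : {set 'I_n} * {set 'I_n} =>
  (#|p.1| == x) && ((p.2 \subset ~: p.1) && (#|p.2| == z)))); last first.
  by move=> p; rewrite inE.
rewrite -(pair_big_dep (fun A : {set 'I_n} => #|A| == x)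
  (fun A B : {set 'I_n} => (B \subset ~: A) && (#|B| == z)) (fun _ _ => 1)) /=.
rewrite (eq_bigr (fun _ => 'C(n - x, z))) => [|A /eqP Ax].
  have := card_draws 'I_n x; rewrite card_ord => <-.
  rewrite sum_nat_const; congr (_ * _).
  by apply: eq_card => A; rewrite inE.
have <- : #|~: A| = n - x by rewrite cardsCs setCK card_ord Ax.
rewrite sum1_card -cards_draws.
by apply: eq_card => B; rewrite !inE.
Qed.

Definition word_value n (p : {set 'I_n} * {set 'I_n}) (i : 'I_n) : nat :=
  if i \in p.1 then 2 else (i \in p.2).

Lemma trinomial_words_gt n x z p p' :
    p \in trinomial_words n x z -> p' \in trinomial_words n x z -> p != p' ->
  exists i, word_value p' i < word_value p i.
Proof.
have sumE r : r \in trinomial_words n x z -> \sum_i word_value r i = x * 2 + z.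
  rewrite inE => /and3P[/eqP<- rdisj /eqP<-].
  rewrite -!sum1_card big_distrl /= [X in X + _]big_mkcond.
  rewrite [X in _ + X]big_mkcond -big_split /=.
  apply: eq_bigr => i _; rewrite /word_value; case: ifP => ir1; last by case: ifP.
  by case: ifP => // /(subsetP rdisj); rewrite inE ir1.
move=> Dp Dp' pp'; apply/existsP; apply: contraNT pp' => /existsPn le.
(* Pointwise comparison with equal sums forces equality everywhere, and the values 2 and 1 recover
   the two disjoint sets. *)
have [_] : \sum_i word_value p i <= \sum_i word_value p' i
    ?= iff [forall i, word_value p i == word_value p' i].
  by apply: leqif_sum => i _; apply/leqif_eq; rewrite leqNgt le.
rewrite !sumE // eqxx => /esym/forallP eqv.
move: Dp Dp'; rewrite !inE => /and3P[_ /subsetP pd _] /and3P[_ /subsetP pd' _].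
case: p p' {le} => [A B] [A' B'] /= in pd pd' eqv *.
rewrite xpair_eqE; apply/andP; split; apply/eqP/setP => i;
  have /eqP := eqv i; have /implyP := pd i; have /implyP := pd' i;
  by rewrite /word_value /= !inE; do 4 case: (_ \in _).
Qed.

Lemma trinomial_system (k x y z : nat) : x + z <= k -> y + z <= k ->
  exists P : 'I_((x + y + z)`! %/ (x`! * y`! * z`!)) -> finseq 2 * finseq 2,
    strong_ab_system 3 k k P.
Proof.
move=> xz yz; pose n := x + (y + z).
have -> : (x + y + z)`! %/ (x`! * y`! * z`!) = #|trinomial_words n x z|.
  rewrite trinomial_div card_trinomial_words /n addKn; congr (_ * _).
    by rewrite -[RHS]bin_sub ?leq_addr // addKn.
  by rewrite [z + y]addnC -[RHS]bin_sub ?leq_addl // addnK.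
pose v p (i : 'I_n) : 'I_3 := inord (word_value p i).
pose v' p (i : 'I_n) : 'I_3 := inord (2 - word_value p i).
have value_le2 p (i : 'I_n) : word_value p i <= 2.
  by rewrite /word_value; case: ifP => // _; case: (_ \in _).
have vE p i : v p i = word_value p i :> nat by rewrite inordK // ltnS value_le2.
have v'E p i : v' p i = 2 - word_value p i :> nat.
  by rewrite inordK // ltnS leq_subr.
exists (fun j => (finseq_of (v (enum_val j)), finseq_of (v' (enum_val j)))).
split; first split=> [j|i j /eqP ij].
- apply/sum_inter_eq0 => //= u; have [un|nu] := ltnP u n; last first.
    by rewrite !finseq_of_out.
  by rewrite (_ : u = Ordinal un) // !finseq_ofE vE v'E subnKC ?value_le2.
- have [u lt_u] : exists u, word_value (enum_val j) u < word_value (enum_val i) u.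
    by apply: (trinomial_words_gt (enum_valP i) (enum_valP j));
      rewrite (inj_eq enum_val_inj).
  (* Where the value of [i] exceeds that of [j], adding the complement to 2 of the latter gives at
     least 3. *)
  move=> /sum_inter_eq0 => /(_ isT) /= /(_ u); rewrite !finseq_ofE vE v'E.
  have := value_le2 (enum_val j) u; move: lt_u.
  by move: (word_value (enum_val i) u) (word_value (enum_val j) u) => a b; lia.
move=> j; have := enum_valP j; set p := enum_val j.
rewrite inE => /and3P[/eqP p1 pdisj /eqP p2] /=.
split; apply: leq_trans (card_finsupp_finseq_of _) _.
  apply: leq_trans xz; rewrite -p1 -p2; apply: leq_trans (leq_card_setU _ _).
  apply/subset_leq_card/subsetP => i; rewrite !inE -val_eqE /= vE /word_value.
  by case: ifP => //= _; case: (_ \in _).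
apply: leq_trans yz; have -> : y + z = #|~: p.1|.
  by rewrite cardsCs setCK card_ord p1 addKn.
apply/subset_leq_card/subsetP => i; rewrite !inE -val_eqE /= v'E /word_value.
by case: ifP.
Qed.

End LowerBound.

(** Induction lowers the bound until it is attained; [A] may be undecidable, hence the excluded
    middle. *)
Lemma bounded_prop_max (A : nat -> Prop) (N : nat) :
  A 0 -> (forall n, A n -> n <= N) ->
  exists m, A m /\ forall n, A n -> n <= m.
Proof.
move=> A0; elim: N => [|N IHN] bound; first by exists 0.
have [AN|AN] := classic (A N.+1); first by exists N.+1.
apply: IHN => n An; rewrite -ltnS ltn_neqAle bound // andbT.
by apply/eqP => nN; rewrite nN in An.
Qed.

Theorem theorem1p8 (k : nat) (hk : 1 <= k) :
  exists m : nat, is_max_size 2 3 k k m /\ max_trinomial k <= m /\ m <= k * max_trinomial k.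
Proof.
pose A m := exists P : 'I_m -> finseq 2 * finseq 2, strong_ab_system 3 k k P.
have A0 : A 0.
  have no_ord0 : 'I_0 -> False by case.
  by exists (fun i => False_rect _ (no_ord0 i)); split; [split|]; case.
have bound n : A n -> n <= k * max_trinomial k.
  by case=> P; apply: strong_system_bound.
have [m [Am max_m]] := bounded_prop_max A0 bound.
exists m; split; [split=> // n P sysP|split; last exact: bound].
  by apply: max_m; exists P.
apply/bigmax_leqP => -[[x y] z] /= /andP[xz yz].
by apply/max_m/trinomial_system.
Qed.
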